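(* Let $[\mathbf{Set},\mathbf{Set}]_S$ be the category of small endofunctors of $\mathbf{Set}$. The identity functor on $[\mathbf{Set},\mathbf{Set}]_S$ is a lax monoidal functor from $([\mathbf{Set},\mathbf{Set}]_S,\circ,\mathrm{Id})$ (composition of functors) to $([\mathbf{Set},\mathbf{Set}]_S,\star,\mathrm{Id})$ (Day convolution), with unit morphism $\eta=\mathrm{id}:\mathrm{Id}\to\mathrm{Id}$ and with $\phi_{F,G}:F\star G\to F\circ G$ whose component at $A$ is induced on the coend $(F\star G)(A)=\int^{C,D}F(C)\times G(D)\times A^{C\times D}$ by the composites $$F(C)\times G(D)\times A^{C\times D}\xrightarrow{\ \mathrm{st}\ }F\big(C\times(G(D)\times A^{C\times D})\big)\xrightarrow{\ F\,\mathrm{st}\ }F\big(G(C\times D\times A^{C\times D})\big)\xrightarrow{\ F(G\,\mathrm{ev})\ }F(G(A)),$$ i.e. $(x,y,k)\mapsto F\big(c\mapsto G(d\mapsto k(c,d))(y)\big)(x)$.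
   Context: A functor $\mathbf{Set}\to\mathbf{Set}$ is small if it is a left Kan extension along the inclusion of a small subcategory of $\mathbf{Set}$. The Day convolution of small functors is $(F\star G)(A)=\int^{C,D}F(C)\times G(D)\times A^{C\times D}$; it makes $([\mathbf{Set},\mathbf{Set}]_S,\star,\mathrm{Id})$ a (symmetric) monoidal category. Here $\mathrm{st}$ denotes the canonical strength of an endofunctor of $\mathbf{Set}$ (used up to the symmetry of $\times$), and $\mathrm{ev}:C\times D\times A^{C\times D}\to A$ is evaluation. A lax monoidal functor $H:(\mathcal{C},\otimes,I)\to(\mathcal{D},\oplus,J)$ is a functor with a natural transformation $\phi_{A,B}:H(A)\oplus H(B)\to H(A\otimes B)$ and a morphism $\eta:J\to H(I)$ satisfying the usual associativity and left and right unit coherence conditions. *)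

(* Defs.v *)
From Corelib Require Import ssreflect.
From Stdlib Require Import FunctionalExtensionality PropExtensionality.
From Stdlib Require Import ProofIrrelevance ClassicalEpsilon.

Set Implicit Arguments.
Unset Strict Implicit.
Unset Printing Implicit Defensive.

(* The category Set is modelled by the types of one fixed universe level,
   classical logic, choice and extensionality being available as axioms.
   "Small" means "living in SET". *)
Definition SET := Type.

Declare Scope cat_scope.
Delimit Scope cat_scope with cat.
Open Scope cat_scope.

Record Category := {
  Ob : Type;
  Hom : Ob -> Ob -> Type;
  idm : forall X, Hom X X;
  comp : forall X Y Z, Hom Y Z -> Hom X Y -> Hom X Z;
  compA : forall W X Y Z (h : Hom Y Z) (g : Hom X Y) (f : Hom W X),
    comp h (comp g f) = comp (comp h g) f;
  comp1m : forall X Y (f : Hom X Y), comp (idm Y) f = f;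
  compm1 : forall X Y (f : Hom X Y), comp f (idm X) = f }.

Arguments Hom {c} X Y.
Arguments idm {c} X.
Arguments comp {c X Y Z} g f.
Notation "g ∘ f" := (comp g f) (at level 40, left associativity) : cat_scope.

Definition is_iso (C : Category) (X Y : Ob C) (f : Hom X Y) : Prop :=
  exists g : Hom Y X, g ∘ f = idm X /\ f ∘ g = idm Y.

Record Functor (C D : Category) := {
  fobj :> Ob C -> Ob D;
  fmap : forall X Y, Hom X Y -> Hom (fobj X) (fobj Y);
  fmap_id : forall X, fmap (idm X) = idm (fobj X);
  fmap_comp : forall X Y Z (g : Hom Y Z) (f : Hom X Y),
    fmap (g ∘ f) = fmap g ∘ fmap f }.

Arguments fmap {C D} F {X Y} f : rename.

Record NatTrans (C D : Category) (F G : Functor C D) := {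
  component :> forall X, Hom (F X) (G X);
  naturality : forall X Y (f : Hom X Y),
    component Y ∘ fmap F f = fmap G f ∘ component X }.

Lemma nat_ext (C D : Category) (F G : Functor C D) (s t : NatTrans F G) :
  (forall X, s X = t X) -> s = t.
Proof.
case: s t => [s hs] [t ht] /= E.
have {}E : s = t by apply: functional_extensionality_dep.
by case: t / E ht => ht; rewrite (proof_irrelevance _ hs ht).
Qed.

Definition id_functor (C : Category) : Functor C C :=
  @Build_Functor C C (fun X => X) (fun X Y f => f)
    (fun X => eq_refl) (fun X Y Z g f => eq_refl).

Program Definition comp_functor (C D E : Category)
    (G : Functor D E) (F : Functor C D) : Functor C E :=
  {| fobj := fun X => G (F X); fmap := fun X Y f => fmap G (fmap F f) |}.
Next Obligation. by rewrite !fmap_id. Qed.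
Next Obligation. by rewrite !fmap_comp. Qed.

Definition id_nat (C D : Category) (F : Functor C D) : NatTrans F F.
Proof.
exists (fun X => idm (F X)) => X Y f; by rewrite comp1m compm1.
Defined.

Definition comp_nat (C D : Category) (F G H : Functor C D)
  (t : NatTrans G H) (s : NatTrans F G) : NatTrans F H.
Proof.
exists (fun X => t X ∘ s X) => X Y f.
by rewrite -compA naturality compA naturality compA.
Defined.

Definition whisker (C D E : Category) (G H : Functor D E)
  (t : NatTrans G H) (F : Functor C D) :
  NatTrans (comp_functor G F) (comp_functor H F).
Proof.
exists (fun X => t (F X)) => X Y f; exact: (naturality t (fmap F f)).
Defined.

Definition is_left_kan (S C D : Category) (i : Functor S C) (K : Functor S D)
    (L : Functor C D) (a : NatTrans K (comp_functor L i)) : Prop :=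
  forall (G : Functor C D) (b : NatTrans K (comp_functor G i)),
  exists! c : NatTrans L G, comp_nat (whisker c i) a = b.

Definition SetCat : Category :=
  @Build_Category SET (fun A B => A -> B) (fun A x => x)
    (fun A B C g f x => g (f x))
    (fun _ _ _ _ _ _ _ => eq_refl) (fun _ _ _ => eq_refl)
    (fun _ _ _ => eq_refl).

Notation Endo := (Functor SetCat SetCat).

(* A small, not necessarily full, subcategory of Set: a set of objects, given
   as the image of the injective family [ss_set], and a set of morphisms
   containing the identities and closed under composition. *)
Record SmallSubcat := {
  ss_ob : SET;
  ss_set : ss_ob -> SET;
  ss_inj : forall i j, ss_set i = ss_set j -> i = j;
  ss_hom : forall i j, (ss_set i -> ss_set j) -> Prop;
  ss_id : forall i, ss_hom (fun x : ss_set i => x);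
  ss_comp : forall i j k (g : ss_set j -> ss_set k) (f : ss_set i -> ss_set j),
    ss_hom g -> ss_hom f -> ss_hom (fun x => g (f x)) }.

Arguments ss_hom : clear implicits.

Lemma sig_eq (T : Type) (P : T -> Prop) (u v : {x | P x}) :
  proj1_sig u = proj1_sig v -> u = v.
Proof. by apply: eq_sig_hprop => x; apply: proof_irrelevance. Qed.

Definition subcat (S : SmallSubcat) : Category.
Proof.
unshelve refine (@Build_Category (ss_ob S)
  (fun i j => {f : ss_set i -> ss_set j | ss_hom S i j f})
  (fun i => exist _ _ (ss_id i))
  (fun i j k g f => exist _ _ (ss_comp (proj2_sig g) (proj2_sig f)))
  _ _ _) => *; exact: sig_eq.
Defined.

Definition inclusion (S : SmallSubcat) : Functor (subcat S) SetCat :=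
  @Build_Functor (subcat S) SetCat (@ss_set S) (fun i j f => proj1_sig f)
    (fun _ => eq_refl) (fun _ _ _ _ _ => eq_refl).

Definition small (F : Endo) : Prop :=
  exists (S : SmallSubcat) (K : Functor (subcat S) SetCat)
         (a : NatTrans K (comp_functor F (inclusion S))),
    is_left_kan a.

Lemma nat_app (C : Category) (F G : Functor C SetCat) (s t : NatTrans F G) :
  s = t -> forall X (x : F X), s X x = t X x.
Proof. by move=> ->. Qed.

(* The category [Set,Set]_S of small endofunctors of Set. *)
Record SmallEndo := { endo :> Endo; endo_small : small endo }.

Definition SmallFun : Category.
Proof.
unshelve refine (@Build_Category SmallEndo (fun F G => NatTrans F G)
  (fun F => id_nat F) (fun F G H t s => comp_nat t s) _ _ _) => *;
by apply: nat_ext.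
Defined.

(* Small endofunctors of Set are the bounded ones. *)

Definition bounded (F : Endo) : Prop :=
  exists (I : SET) (J : I -> SET), forall (A : SET) (x : F A),
  exists (i : I) (f : J i -> A) (y : F (J i)), fmap F f y = x.

Section EndoLemmas.
Variable F : Endo.

Lemma endo_id (A : SET) (x : F A) : fmap F (fun a : A => a) x = x.
Proof. by move: (fmap_id F A) => /= ->. Qed.

Lemma endo_idf (A : SET) : fmap F (fun a : A => a) = fun x => x.
Proof. exact: (fmap_id F A). Qed.

Lemma endo_comp (A B C : SET) (g : B -> C) (f : A -> B) (x : F A) :
  fmap F g (fmap F f x) = fmap F (fun a => g (f a)) x.
Proof. by move: (@fmap_comp _ _ F A B C g f) => /= ->. Qed.

End EndoLemmas.

Lemma nat_endo (F G : Endo) (s : NatTrans F G) (A B : SET) (f : A -> B)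
  (x : F A) : s B (fmap F f x) = fmap G f (s A x).
Proof. by have /= /(f_equal (fun h => h x)) := @naturality _ _ _ _ s A B f. Qed.

Lemma small_bounded (F : Endo) : small F -> bounded F.
Proof.
case=> [S [K [a La]]]; exists (ss_ob S), (@ss_set S).
pose P (A : SET) (x : F A) := exists (i : ss_ob S) (f : ss_set i -> A) y, fmap F f y = x.
have Pmap (A B : SET) (g : A -> B) x : P A x -> P B (fmap F g x).
  by case=> [i [f [y <-]]]; exists i, (fun z => g (f z)), y; rewrite endo_comp.
pose F'map (A B : SET) (g : A -> B) (x : {x | P A x}) : {x | P B x} :=
  exist _ _ (Pmap A B g (proj1_sig x) (proj2_sig x)).
have F'1 (A : SET) : F'map A A (fun x => x) = (fun x => x).
  by apply: functional_extensionality => x; apply: sig_eq; rewrite /= endo_id.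
have F'M (A B C : SET) (g : B -> C) (f : A -> B) :
    F'map A C (fun x => g (f x)) = (fun x => F'map B C g (F'map A B f x)).
  by apply: functional_extensionality => x; apply: sig_eq; rewrite /= endo_comp.
pose F' : Endo := @Build_Functor SetCat SetCat (fun A => {x | P A x}) F'map F'1 F'M.
have incl : {c : NatTrans F' F | forall A x, c A x = proj1_sig x}.
  by unshelve (eexists (@Build_NatTrans _ _ F' F (fun A x => proj1_sig x) _)).
case: incl => incl inclE.
have Pa i (x : K i) : P (ss_set i) (a i x).
  by exists i, (fun z => z), (a i x); rewrite endo_id.
unshelve epose (b := @Build_NatTrans _ _ K (comp_functor F' (inclusion S))
   (fun i x => exist _ _ (Pa i x)) _).
  move=> i j f; apply: functional_extensionality => x; apply: sig_eq => /=.
  by have /= /(f_equal (fun h => h x)) := @naturality _ _ _ _ a i j f.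
have [c [cE _]] := La F' b.
have [d [dE d_uniq]] := La F a.
have E1 : comp_nat incl c = id_nat F.
  transitivity d; last by apply: d_uniq; apply: nat_ext.
  symmetry; apply: d_uniq.
  apply: nat_ext => i; apply: functional_extensionality => x /=.
  rewrite inclE; exact: (f_equal (@proj1_sig _ _) (nat_app cE x)).
move=> A x; have /= := nat_app E1 x.
by rewrite inclE => <-; exact: (proj2_sig (c A x)).
Qed.

(* Every family of sets can be reindexed as an injective one. *)
Lemma injective_family (I : SET) (J : I -> SET) :
  exists (I' : SET) (J' : I' -> SET), (forall i j, J' i = J' j -> i = j) /\
    forall i, exists i', J' i' = J i.
Proof.
pose r (T : SET) (H : exists j, J j = T) :=
  proj1_sig (constructive_indefinite_description _ H).
pose rep i := r (J i) (ex_intro _ i eq_refl).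
have repE i : J (rep i) = J i.
  by rewrite /rep /r; case: constructive_indefinite_description.
have rep_eq i j : J i = J j -> rep i = rep j.
  rewrite /rep; move: (ex_intro _ i _) (ex_intro _ j _) => H H' E.
  by case: _ / E H' => H'; rewrite (proof_irrelevance _ H H').
exists {i | rep i = i}, (fun i => J (proj1_sig i)); split.
  move=> [i hi] [j hj] /= /rep_eq E; apply: sig_eq => /=; by rewrite -hi -hj.
move=> i; have h : rep (rep i) = rep i by exact: rep_eq.
exists (exist (fun i => rep i = i) _ h); exact: repE.
Qed.

Lemma bounded_small (F : Endo) : bounded F -> small F.
Proof.
case=> [I [J FJ]].
(* the sets J i, and the quotients of the sets J i + J j + 1 *)
pose X i j : SET := (J i + J j + unit)%type.
pose Q (t : {i : I & {j : I & X i j -> X i j -> Prop}}) : SET :=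
  {p | exists x, p = projT2 (projT2 t) x}.
pose I1 : SET := (I + {i : I & {j : I & X i j -> X i j -> Prop}})%type.
pose J1 (i : I1) : SET := match i with inl i => J i | inr t => Q t end.
have [I2 [J2 [J2inj J2J1]]] := injective_family J1.
pose S := @Build_SmallSubcat I2 J2 J2inj (fun _ _ _ => True)
  (fun _ => Logic.I) (fun _ _ _ _ _ _ _ => Logic.I).
pose K := comp_functor F (inclusion S).
exists S, K, (id_nat K) => G b.
have bE i j (f : J2 i -> J2 j) y : b j (fmap F f y) = fmap G f (b i y).
  by have /= /(f_equal (fun h => h y)) :=
     @naturality _ _ _ _ b i j (exist _ f Logic.I).
have F2 (A : SET) (x : F A) : exists (i : I2) (f : J2 i -> A) y, fmap F f y = x.
  have [i [f [y <-]]] := FJ A x; have [i' E] := J2J1 (inl i).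
  move: f y; rewrite -[J i]/(J1 (inl i)) -E => f y; by exists i', f, y.
have wd0 (A : SET) i j (f : J i -> A) (g : J j -> A) :
  exists (k : I2) (h : J2 k -> A) (f' : J i -> J2 k) (g' : J j -> J2 k),
    (f = fun x => h (f' x)) /\ (g = fun x => h (g' x)) /\
    forall x y, fmap F h x = fmap F h y -> x = y.
  case: (excluded_middle_informative (inhabited A)) => [[a0]|nA]; last first.
    have [k E] := J2J1 (inl i).
    have nf (T : Type) (x : J i) : T by case: nA; split; exact: f.
    have ng (T : Type) (x : J j) : T by case: nA; split; exact: g.
    have h : J2 k -> A by rewrite E.
    exists k, h, (fun x => nf _ x), (fun x => ng _ x).
    split; first by apply: functional_extensionality => x; apply: (nf _ x).
    split; first by apply: functional_extensionality => x; apply: (ng _ x).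
    move=> x y Exy.
    pose r : A -> J2 k := fun a => match nA (inhabits a) with end.
    have rh : (fun x => r (h x)) = fun x => x.
      apply: functional_extensionality => z; case: (nA (inhabits (h z))).
    by move: Exy => /(f_equal (fmap F r)); rewrite !endo_comp rh !endo_id.
  pose e (x : X i j) : A :=
    match x with inl (inl x) => f x | inl (inr x) => g x | inr _ => a0 end.
  pose t : {i : I & {j : I & X i j -> X i j -> Prop}} :=
    existT _ i (existT _ j (fun x y => e x = e y)).
  have [k E] := J2J1 (inr t).
  suff: exists (h : J1 (inr t) -> A) (f' : J i -> J1 (inr t))
      (g' : J j -> J1 (inr t)),
    (f = fun x => h (f' x)) /\ (g = fun x => h (g' x)) /\
    forall x y, fmap F h x = fmap F h y -> x = y by rewrite -E => ?; exists k.
  pose cl (x : X i j) : Q t := exist _ _ (ex_intro _ x eq_refl).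
  have hP (q : Q t) : exists x, q = cl x.
    by case: q => p [x Ep]; exists x; apply: sig_eq.
  pose sec (q : Q t) := proj1_sig (constructive_indefinite_description _ (hP q)).
  have secK q : cl (sec q) = q.
    by rewrite /sec; case: constructive_indefinite_description.
  have clE x y : cl x = cl y <-> e x = e y.
    split; last first.
      move=> E1; apply: sig_eq => /=; apply: functional_extensionality => z.
      by rewrite E1.
    move=> /(f_equal (fun q => proj1_sig q y)) /= ->; by [].
  pose h (q : Q t) := e (sec q).
  have hcl x : h (cl x) = e x by apply/clE; rewrite secK.
  exists h, (fun x => cl (inl (inl x))), (fun x => cl (inl (inr x))).
  split; first by apply: functional_extensionality => x; rewrite hcl.
  split; first by apply: functional_extensionality => x; rewrite hcl.
  pose r (a : A) : Q t :=
    match excluded_middle_informative (exists q, h q = a) with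
    | left H => proj1_sig (constructive_indefinite_description _ H)
    | right _ => cl (inr tt)
    end.
  have rh : (fun q => r (h q)) = fun q => q.
    apply: functional_extensionality => q; rewrite /r.
    case: excluded_middle_informative => [H|[]]; last by exists q.
    case: constructive_indefinite_description => q' /= Eq.
    by rewrite -(secK q) -(secK q'); apply/clE.
  by move=> x y /(f_equal (fmap F r)); rewrite !endo_comp rh !endo_id.
have wd (A : SET) i j (f : J2 i -> A) (g : J2 j -> A) x y :
  fmap F f x = fmap F g y -> fmap G f (b i x) = fmap G g (b j y).
  have [i0 [f0 [x0 Ex]]] := FJ _ x; have [j0 [g0 [y0 Ey]]] := FJ _ y.
  have [k [h [f' [g' [Ef [Eg hinj]]]]]] :=
    wd0 A i0 j0 (fun z => f (f0 z)) (fun z => g (g0 z)).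
  have [i1 E1] := J2J1 (inl i0); have [j1 E2] := J2J1 (inl j0).
  move: f0 x0 f' Ex Ef; rewrite -[J i0]/(J1 (inl i0)) -E1 => f0 x0 f' Ex Ef.
  move: g0 y0 g' Ey Eg; rewrite -[J j0]/(J1 (inl j0)) -E2 => g0 y0 g' Ey Eg.
  rewrite -Ex -Ey !bE !endo_comp Ef Eg.
  rewrite -(@endo_comp F _ _ _ h f') -(@endo_comp F _ _ _ h g') => /hinj E.
  by rewrite -(@endo_comp G _ _ _ h f') -(@endo_comp G _ _ _ h g') -!bE E.
pose R (A : SET) (x : F A) (z : G A) :=
  exists (i : I2) (f : J2 i -> A) y, fmap F f y = x /\ z = fmap G f (b i y).
have R_ex (A : SET) (x : F A) : exists z, R A x z.
  by have [i [f [y <-]]] := F2 A x; exists (fmap G f (b i y)), i, f, y.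
have R_fun (A : SET) (x : F A) z z' : R A x z -> R A x z' -> z = z'.
  by move=> [i [f [y [<- ->]]]] [j [g [y' [E ->]]]]; apply: wd.
pose c0 (A : SET) (x : F A) : G A :=
  proj1_sig (constructive_indefinite_description _ (R_ex A x)).
have c0R (A : SET) (x : F A) : R A x (c0 A x).
  by rewrite /c0; case: constructive_indefinite_description.
unshelve epose (c := @Build_NatTrans _ _ F G c0 _).
  move=> A B g; apply: functional_extensionality => x /=.
  apply: (R_fun _ _ _ _ (c0R _ _)).
  have [i [f [y [<- ->]]]] := c0R A x.
  by exists i, (fun z => g (f z)), y; rewrite !endo_comp.
exists c; split.
  apply: nat_ext => i; apply: functional_extensionality => x /=.
  apply: (R_fun _ _ _ _ (c0R _ _)).
  by exists i, (fun z => z), x; rewrite endo_id endo_id.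
move=> c' c'E; apply: nat_ext => A; apply: functional_extensionality => x /=.
have [i [f [y [<- ->]]]] := c0R A x.
rewrite nat_endo; congr (fmap G f); exact: (eq_sym (nat_app c'E y)).
Qed.

Lemma small_id : small (id_functor SetCat).
Proof.
apply: bounded_small; exists unit, (fun _ => unit) => A x.
by exists tt, (fun _ => x), tt.
Qed.

Lemma small_comp (F G : Endo) : small F -> small G -> small (comp_functor F G).
Proof.
move=> /small_bounded [I [J FJ]] /small_bounded [I' [J' GJ]].
apply: bounded_small.
exists {i : I & J i -> I'}.
exists (fun t : {i : I & J i -> I'} => {p : J (projT1 t) & J' (projT2 t p)}) => A x.
have [i [f [y <-]]] := FJ _ x.
have GJ1 (p : J i) : exists t : {i' : I' & ((J' i' -> A) * G (J' i'))%type},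
    fmap G (fst (projT2 t)) (snd (projT2 t)) = f p.
  by have [i' [g [z E]]] := GJ _ (f p); exists (existT _ i' (g, z)).
pose t p := proj1_sig (constructive_indefinite_description _ (GJ1 p)).
have tE p : fmap G (fst (projT2 (t p))) (snd (projT2 (t p))) = f p.
  by rewrite /t; case: constructive_indefinite_description.
pose s : {i : I & J i -> I'} := existT (fun i => J i -> I') i (fun p => projT1 (t p)).
exists s, (fun q => fst (projT2 (t (projT1 q))) (projT2 q)).
exists (fmap F (fun p => fmap G (fun z => existT _ p z) (snd (projT2 (t p)))) y).
rewrite /= endo_comp; congr (fmap F _ y).
by apply: functional_extensionality => p; rewrite endo_comp -tE.
Qed.

Section DayCoend.
Variables F G : Endo.

(* Families of maps F(C) x G(D) x A^(C x D) -> X, in curried form. *)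
Definition day_family (A X : SET) : Type :=
  forall C D : SET, F C -> G D -> (C * D -> A) -> X.

(* F(C) x G(D) x A^(C' x D') is covariant in (C, D) and contravariant in
   (C', D'); the two sides are the two ways of going from
   F(C) x G(D) x A^(C' x D') to X. *)
Definition is_cowedge (A X : SET) (w : day_family A X) : Prop :=
  forall (C C' D D' : SET) (f : C -> C') (g : D -> D')
         (x : F C) (y : G D) (k : C' * D' -> A),
    w C D x y (fun p => k (f (fst p), g (snd p))) =
    w C' D' (fmap F f x) (fmap G g y) k.

(* A coend, in SET, over all the objects C and D of Set. *)
Record DayCoend (A : SET) := {
  coend : SET;
  coend_in : day_family A coend;
  coend_cowedge : is_cowedge coend_in;
  coend_univ : forall (X : SET) (w : day_family A X), is_cowedge w ->
    exists! h : coend -> X, forall C D (x : F C) (y : G D) (k : C * D -> A),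
      h (coend_in x y k) = w C D x y k }.

Lemma day_coend_exists (A : SET) : small F -> small G ->
  exists _ : DayCoend A, True.
Proof.
move=> /small_bounded [I [J FJ]] /small_bounded [I' [J' GJ]].
pose T : SET := {i : I & {j : I' & (F (J i) * G (J' j) * (J i * J' j -> A))%type}}.
pose app (X : SET) (w : day_family A X) (t : T) : X :=
  let u := projT2 (projT2 t) in w _ _ (fst (fst u)) (snd (fst u)) (snd u).
pose E (t t' : T) := forall (X : SET) (w : day_family A X),
  is_cowedge w -> app X w t = app X w t'.
pose Q : SET := {p : T -> Prop | exists t, p = E t}.
pose cl (t : T) : Q := exist _ _ (ex_intro _ t eq_refl).
have clE t t' : E t t' -> cl t = cl t'.
  move=> H; apply: sig_eq; apply: functional_extensionality => s /=.
  apply: propositional_extensionality; split=> H' X w hw.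
    by rewrite -(H X w hw) (H' X w hw).
  by rewrite (H X w hw) (H' X w hw).
have EQ t t' : cl t = cl t' -> E t t'.
  by move=> /(f_equal (fun q => proj1_sig q t')) /= -> X w.
have rep_ex (q : Q) : exists t, q = cl t.
  by case: q => p [t Ep]; exists t; apply: sig_eq.
have norm (C D : SET) (x : F C) (y : G D) (k : C * D -> A) : exists t : T,
    forall X w, is_cowedge w -> app X w t = w C D x y k.
  have [i [f [x0 <-]]] := FJ _ x; have [j [g [y0 <-]]] := GJ _ y.
  exists (existT _ i (existT _ j (x0, y0, fun p => k (f (fst p), g (snd p))))).
  by move=> X w hw; exact: hw.
pose nf C D x y k := proj1_sig (constructive_indefinite_description _ (norm C D x y k)).
have nfE C D x y k X w : is_cowedge w -> app X w (nf C D x y k) = w C D x y k.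
  by rewrite /nf; case: constructive_indefinite_description => t /= H /H.
unshelve eexists (@Build_DayCoend A Q (fun C D x y k => cl (nf C D x y k)) _ _) => //.
  move=> C C' D D' f g x y k; apply: clE => X w hw.
  rewrite !(nfE _ _ _ _ _ _ _ hw); exact: hw.
move=> X w hw.
pose rep q := proj1_sig (constructive_indefinite_description _ (rep_ex q)).
have repK q : q = cl (rep q).
  by rewrite /rep; case: constructive_indefinite_description.
exists (fun q => app X w (rep q)); split.
  move=> C D x y k; rewrite -(nfE _ _ _ _ _ _ _ hw).
  by have /EQ H := repK (cl (nf C D x y k)); rewrite -(H X w hw).
move=> h hE; apply: functional_extensionality => q.
have [i [j [[x y] k]]] := rep q.
rewrite {2}(repK q).
rewrite /app -hE; congr h; apply: clE => Y v hv.
by rewrite nfE.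
Qed.

End DayCoend.

Arguments day_family : clear implicits.

(* The set (F * G)(A); it is determined up to a unique isomorphism compatible
   with the injections of the coend. *)
Definition day_coend (F G : SmallEndo) (A : SET) : DayCoend F G A :=
  proj1_sig (constructive_indefinite_description _
    (day_coend_exists A (endo_small F) (endo_small G))).

Definition day (F G : SmallEndo) (A : SET) : SET := coend (day_coend F G A).

Definition day_in (F G : SmallEndo) (A C D : SET)
  (x : F C) (y : G D) (k : C * D -> A) : day F G A :=
  coend_in (day_coend F G A) x y k.

Lemma day_in_eq (F G : SmallEndo) (A C D : SET) (x : F C) (y : G D)
  (k k' : C * D -> A) : (forall p, k p = k' p) -> day_in x y k = day_in x y k'.
Proof. by move=> E; congr day_in; apply: functional_extensionality. Qed.

Section Day.
Variables (F G : SmallEndo) (A : SET).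

Lemma day_cowedge : is_cowedge (@day_in F G A).
Proof. exact: (@coend_cowedge _ _ _ (day_coend F G A)). Qed.

Lemma day_cowedge_l (C C' D : SET) (f : C -> C') (x : F C) (y : G D)
    (k : C' * D -> A) :
  day_in x y (fun p => k (f (fst p), snd p)) = day_in (fmap F f x) y k.
Proof.
by rewrite -[y in RHS](endo_id (F := G)) -(day_cowedge f (fun d => d)).
Qed.

Lemma day_cowedge_r (C D D' : SET) (g : D -> D') (x : F C) (y : G D)
    (k : C * D' -> A) :
  day_in x y (fun p => k (fst p, g (snd p))) = day_in x (fmap G g y) k.
Proof.
by rewrite -[x in RHS](endo_id (F := F)) -(day_cowedge (fun c => c) g).
Qed.

Definition day_lift (X : SET) (w : day_family F G A X) (hw : is_cowedge w) :
    day F G A -> X :=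
  proj1_sig (constructive_indefinite_description _ (@coend_univ _ _ _ (day_coend F G A) _ _ hw)).

Lemma day_liftE (X : SET) (w : day_family F G A X) (hw : is_cowedge w)
    (C D : SET) (x : F C) (y : G D) (k : C * D -> A) :
  day_lift hw (day_in x y k) = w C D x y k.
Proof.
by rewrite /day_lift; case: constructive_indefinite_description => h /= [hE _]; exact: hE.
Qed.

Lemma day_ext (X : SET) (h h' : day F G A -> X) :
  (forall C D (x : F C) (y : G D) k,
    h (@day_in F G A C D x y k) = h' (day_in x y k)) -> forall t, h t = h' t.
Proof.
move=> E t.
have hw : is_cowedge (fun C D x y k => h' (@day_in F G A C D x y k)).
  by move=> C C' D D' f g x y k /=; rewrite (day_cowedge f g).
have [u [_ uu]] := @coend_univ _ _ _ (day_coend F G A) _ _ hw.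
by rewrite -(uu h) // -(uu h').
Qed.

Lemma day_ind (P : day F G A -> Prop) :
  (forall C D (x : F C) (y : G D) k, P (@day_in F G A C D x y k)) ->
  forall t, P t.
Proof.
move=> H t.
rewrite (@day_ext Prop P (fun _ => True)) // => C D x y k.
by apply: propositional_extensionality; split.
Qed.

End Day.

Lemma day_map_subproof (F G : SmallEndo) (A B : SET) (u : A -> B) :
  is_cowedge (fun C D (x : F C) (y : G D) k =>
    day_in x y (fun p : C * D => u (k p))).
Proof.
by move=> C C' D D' f g x y k /=; rewrite -(day_cowedge f g).
Qed.

Definition day_map (F G : SmallEndo) (A B : SET) (u : A -> B) :
  day F G A -> day F G B := day_lift (day_map_subproof u).

Lemma day_mapE (F G : SmallEndo) (A B C D : SET) (u : A -> B)
    (x : F C) (y : G D) (k : C * D -> A) :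
  day_map u (day_in x y k) = day_in x y (fun p => u (k p)).
Proof. exact: day_liftE. Qed.

Definition day_endo (F G : SmallEndo) : Endo.
Proof.
unshelve refine (@Build_Functor SetCat SetCat (fun A => day F G A)
  (fun A B u => day_map u) _ _) => * /=; apply: functional_extensionality;
by apply: day_ext => *; rewrite !day_mapE.
Defined.

Lemma day_endoE (F G : SmallEndo) (A B C D : SET) (u : A -> B)
    (x : F C) (y : G D) (k : C * D -> A) :
  fmap (day_endo F G) u (day_in x y k) = day_in x y (fun p => u (k p)).
Proof. exact: day_liftE. Qed.

Lemma day_small (F G : SmallEndo) : small (day_endo F G).
Proof.
have [I [J FJ]] := small_bounded (endo_small F).
have [I' [J' GJ]] := small_bounded (endo_small G).
apply: bounded_small.
exists (I * I')%type, (fun i => (J (fst i) * J' (snd i))%type) => A.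
apply: day_ind => C D x y k.
have [i [f [x0 <-]]] := FJ _ x; have [j [g [y0 <-]]] := GJ _ y.
exists (i, j), (fun p => k (f (fst p), g (snd p))), (day_in x0 y0 (fun p => p)).
by rewrite day_endoE -(day_cowedge f g).
Qed.

Record MonoidalCategory := {
  mcat :> Category;
  tens : Ob mcat -> Ob mcat -> Ob mcat;
  tensm : forall X X' Y Y', Hom X X' -> Hom Y Y' -> Hom (tens X Y) (tens X' Y');
  tensm_id : forall X Y, tensm (idm X) (idm Y) = idm (tens X Y);
  tensm_comp : forall X X' X'' Y Y' Y'' (f' : Hom X' X'') (f : Hom X X')
      (g' : Hom Y' Y'') (g : Hom Y Y'),
    tensm (f' ∘ f) (g' ∘ g) = tensm f' g' ∘ tensm f g;
  munit : Ob mcat;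
  assoc : forall X Y Z, Hom (tens (tens X Y) Z) (tens X (tens Y Z));
  lunit : forall X, Hom (tens munit X) X;
  runit : forall X, Hom (tens X munit) X;
  assoc_iso : forall X Y Z, is_iso (assoc X Y Z);
  lunit_iso : forall X, is_iso (lunit X);
  runit_iso : forall X, is_iso (runit X);
  assoc_nat : forall X X' Y Y' Z Z' (f : Hom X X') (g : Hom Y Y') (h : Hom Z Z'),
    assoc X' Y' Z' ∘ tensm (tensm f g) h = tensm f (tensm g h) ∘ assoc X Y Z;
  lunit_nat : forall X X' (f : Hom X X'),
    lunit X' ∘ tensm (idm munit) f = f ∘ lunit X;
  runit_nat : forall X X' (f : Hom X X'),
    runit X' ∘ tensm f (idm munit) = f ∘ runit X;
  triangle : forall X Y,
    tensm (idm X) (lunit Y) ∘ assoc X munit Y = tensm (runit X) (idm Y);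
  pentagon : forall W X Y Z,
    tensm (idm W) (assoc X Y Z) ∘ assoc W (tens X Y) Z ∘ tensm (assoc W X Y) (idm Z)
    = assoc W X (tens Y Z) ∘ assoc (tens W X) Y Z }.

Arguments tens {m} X Y.
Arguments tensm {m X X' Y Y'} f g.
Arguments munit {m}.
Arguments assoc {m} X Y Z.
Arguments lunit {m} X.
Arguments runit {m} X.

Record LaxMonoidal (M N : MonoidalCategory) (H : Functor M N) := {
  lax_mul : forall X Y : Ob M, Hom (tens (H X) (H Y)) (H (tens X Y));
  lax_unit : Hom munit (H munit);
  lax_mul_nat : forall (X X' Y Y' : Ob M) (f : Hom X X') (g : Hom Y Y'),
    lax_mul X' Y' ∘ tensm (fmap H f) (fmap H g) = fmap H (tensm f g) ∘ lax_mul X Y;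
  lax_assoc : forall X Y Z : Ob M,
    fmap H (assoc X Y Z) ∘ lax_mul (tens X Y) Z ∘ tensm (lax_mul X Y) (idm (H Z))
    = lax_mul X (tens Y Z) ∘ tensm (idm (H X)) (lax_mul Y Z)
      ∘ assoc (H X) (H Y) (H Z);
  lax_lunit : forall X : Ob M,
    fmap H (lunit X) ∘ lax_mul munit X ∘ tensm lax_unit (idm (H X)) = lunit (H X);
  lax_runit : forall X : Ob M,
    fmap H (runit X) ∘ lax_mul X munit ∘ tensm (idm (H X)) lax_unit = runit (H X) }.

(* ([Set,Set]_S, ∘, Id) is a strict monoidal category: the components of the
   associator and of the unitors are identity maps. *)

Definition Id_small : SmallEndo := Build_SmallEndo small_id.

Definition comp_small (F G : SmallEndo) : SmallEndo :=
  Build_SmallEndo (small_comp (endo_small F) (endo_small G)).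

Definition comp_map (F F' G G' : SmallEndo) (s : NatTrans F F') (t : NatTrans G G') :
  NatTrans (comp_small F G) (comp_small F' G').
Proof.
exists (fun A x => s (G' A) (fmap F (t A) x)) => A B u.
apply: functional_extensionality => x /=.
rewrite -(nat_endo s) !endo_comp; congr (s _ (fmap F _ x)).
by apply: functional_extensionality => y; rewrite nat_endo.
Defined.

(* The transformation with identity components between two functors whose
   actions on objects and on maps are convertible. *)
Notation id_components F G :=
  (@Build_NatTrans SetCat SetCat (endo F) (endo G) (fun A x => x)
     (fun A B u => eq_refl)) (only parsing).

Definition SmallComp : MonoidalCategory.
Proof.
unshelve refine (@Build_MonoidalCategory SmallFun comp_small comp_map _ _ Id_small
  (fun F G H => id_components (comp_small (comp_small F G) H)
                              (comp_small F (comp_small G H)))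
  (fun F => id_components (comp_small Id_small F) F)
  (fun F => id_components (comp_small F Id_small) F)
  _ _ _ _ _ _ _ _).
- by move=> F G; apply: nat_ext => A; apply: functional_extensionality => x;
  rewrite /= endo_id.
- move=> F F' F'' G G' G'' s' s t' t; apply: nat_ext => A.
  apply: functional_extensionality => x /=.
  by rewrite -(nat_endo s) endo_comp.
- move=> F G H; exists (id_components (comp_small F (comp_small G H))
    (comp_small (comp_small F G) H)); by split; apply: nat_ext.
- move=> F; exists (id_components F (comp_small Id_small F)).
  by split; apply: nat_ext.
- move=> F; exists (id_components F (comp_small F Id_small)).
  by split; apply: nat_ext.
- move=> F F' G G' H H' s t r; apply: nat_ext => A.
  apply: functional_extensionality => x /=.
  by rewrite !endo_comp.
- by move=> F F' s; apply: nat_ext.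
- move=> F F' s; apply: nat_ext => A.
  apply: functional_extensionality => x /=; by rewrite endo_id.
- by move=> F G; apply: nat_ext.
- move=> F G H K; apply: nat_ext => A; apply: functional_extensionality => x /=.
  by rewrite !endo_idf.
Defined.

(* ([Set,Set]_S, ⋆, Id). *)

Definition day_star (F G : SmallEndo) : SmallEndo := Build_SmallEndo (day_small F G).

(* s ⋆ t : [x, y, k] |-> [s x, t y, k] *)
Lemma day_tensm_subproof (F F' G G' : SmallEndo) (s : NatTrans F F')
    (t : NatTrans G G') (A : SET) :
  is_cowedge (fun C D (x : F C) (y : G D) k => @day_in F' G' A C D (s C x) (t D y) k).
Proof.
by move=> C C' D D' f g x y k; rewrite (day_cowedge f g) -!nat_endo.
Qed.

Definition day_tensm (F F' G G' : SmallEndo) (s : NatTrans F F') (t : NatTrans G G') :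
  NatTrans (day_star F G) (day_star F' G').
Proof.
exists (fun A => day_lift (@day_tensm_subproof F F' G G' s t A)) => A B u.
apply: functional_extensionality; apply: day_ext => C D x y k /=.
by rewrite !day_mapE !day_liftE !day_mapE.
Defined.

Lemma day_tensmE (F F' G G' : SmallEndo) (s : NatTrans F F') (t : NatTrans G G')
    (A C D : SET) (x : F C) (y : G D) (k : C * D -> A) :
  day_tensm s t A (day_in x y k) = day_in (s C x) (t D y) k.
Proof. exact: day_liftE. Qed.

(* Id ⋆ F -> F : [c, y, k] |-> F(k(c, -))(y) *)
Lemma day_lunit_subproof (F : SmallEndo) (A : SET) :
  @is_cowedge Id_small F A (F A)
    (fun C D c y k => fmap F (fun d => k (c, d)) y).
Proof. by move=> C C' D D' f g x y k; rewrite endo_comp. Qed.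

Definition day_lunit (F : SmallEndo) : NatTrans (day_star Id_small F) F.
Proof.
exists (fun A => day_lift (@day_lunit_subproof F A)) => A B u.
apply: functional_extensionality; apply: day_ext => C D x y k /=.
by rewrite day_mapE !day_liftE endo_comp.
Defined.

Lemma day_lunitE (F : SmallEndo) (A C D : SET) (c : C) (y : F D) (k : C * D -> A) :
  day_lunit F A (@day_in Id_small F A C D c y k) = fmap F (fun d => k (c, d)) y.
Proof. exact: day_liftE. Qed.

(* F ⋆ Id -> F : [x, d, k] |-> F(k(-, d))(x) *)
Lemma day_runit_subproof (F : SmallEndo) (A : SET) :
  @is_cowedge F Id_small A (F A)
    (fun C D x d k => fmap F (fun c => k (c, d)) x).
Proof. by move=> C C' D D' f g x y k; rewrite endo_comp. Qed.

Definition day_runit (F : SmallEndo) : NatTrans (day_star F Id_small) F.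
Proof.
exists (fun A => day_lift (@day_runit_subproof F A)) => A B u.
apply: functional_extensionality; apply: day_ext => C D x y k /=.
by rewrite day_mapE !day_liftE endo_comp.
Defined.

Lemma day_runitE (F : SmallEndo) (A C D : SET) (x : F C) (d : D) (k : C * D -> A) :
  day_runit F A (@day_in F Id_small A C D x d k) = fmap F (fun c => k (c, d)) x.
Proof. exact: day_liftE. Qed.

(* (F ⋆ G) ⋆ H -> F ⋆ (G ⋆ H) :
   [[x, y, k], z, h] |-> [x, [y, z, id], (c, (d, e)) |-> h (k (c, d), e)] *)
Section Associator.
Variables F G H : SmallEndo.

Lemma assoc_inner_subproof (A B E : SET) :
  is_cowedge (fun C D (x : F C) (y : G D) (k : C * D -> B)
      (z : H E) (h : B * E -> A) =>
    @day_in F (day_star G H) A C (D * E)%type x (day_in y z (fun p => p))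
      (fun q => h (k (fst q, fst (snd q)), snd (snd q)))).
Proof.
move=> C C' D D' f g x y k; apply: functional_extensionality => z.
apply: functional_extensionality => h.
rewrite -{2}[z](endo_id (F := H)) -(day_cowedge g (fun e : E => e)).
rewrite -(day_endoE (fun p : D * E => (g (fst p), snd p)) y z (fun p => p)).
by rewrite -(@day_cowedge F (day_star G H) A C C' _ _ f
  (fun p : D * E => (g (fst p), snd p))).
Qed.

Lemma assoc_subproof (A : SET) :
  @is_cowedge (day_star F G) H A _ (fun B E (t : day F G B) (z : H E) (h : B * E -> A) =>
    day_lift (@assoc_inner_subproof A B E) t z h).
Proof.
move=> B B' E E' f g t z h; move: t; apply: (@day_ind F G B) => C D x y k.
rewrite day_endoE !day_liftE.
rewrite -{2}[y](endo_id (F := G)) -(day_cowedge (fun d : D => d) g).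
rewrite -(day_endoE (fun p : D * E => (fst p, g (snd p))) y z (fun p => p)).
rewrite -{2}[x](endo_id (F := F)).
by rewrite -(@day_cowedge F (day_star G H) A C C _ _ (fun c : C => c)
  (fun p : D * E => (fst p, g (snd p)))).
Qed.

Definition day_assoc :
  NatTrans (day_star (day_star F G) H) (day_star F (day_star G H)).
Proof.
exists (fun A => day_lift (@assoc_subproof A)) => A B u.
apply: functional_extensionality; apply: day_ext => C D t z h.
move: t; apply: (@day_ind F G C) => C' D' x y k /=.
by rewrite !day_mapE !day_liftE !day_mapE.
Defined.

Lemma day_assocE (A B C D E : SET) (x : F C) (y : G D) (k : C * D -> B)
    (z : H E) (h : B * E -> A) :
  day_assoc A (@day_in (day_star F G) H A B E (day_in x y k) z h) =
  @day_in F (day_star G H) A C (D * E)%type x (day_in y z (fun p => p))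
    (fun q => h (k (fst q, fst (snd q)), snd (snd q))).
Proof. by rewrite /= !day_liftE. Qed.

(* [x, [y, z, k], h] |-> [[x, y, id], z, ((c, d), e) |-> h (c, k (d, e))] *)
Lemma assoc_inv_inner_subproof (A B C : SET) :
  is_cowedge (fun D E (y : G D) (z : H E) (k : D * E -> B)
      (x : F C) (h : C * B -> A) =>
    @day_in (day_star F G) H A (C * D)%type E (day_in x y (fun p => p)) z
      (fun q => h (fst (fst q), k (snd (fst q), snd q)))).
Proof.
move=> D D' E E' f g y z k; apply: functional_extensionality => x.
apply: functional_extensionality => h.
rewrite -{2}[x](endo_id (F := F)) -(day_cowedge (fun c : C => c) f).
rewrite -(day_endoE (fun p : C * D => (fst p, f (snd p))) x y (fun p => p)).
by rewrite -(@day_cowedge (day_star F G) H A _ _ E E'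
  (fun p : C * D => (fst p, f (snd p))) g).
Qed.

Lemma assoc_inv_subproof (A : SET) :
  @is_cowedge F (day_star G H) A _ (fun C B (x : F C) (t : day G H B) (h : C * B -> A) =>
    day_lift (@assoc_inv_inner_subproof A B C) t x h).
Proof.
move=> C C' B B' f g x t h; move: t; apply: (@day_ind G H B) => D E y z k.
rewrite day_endoE !day_liftE.
rewrite -{2}[y](endo_id (F := G)) -(day_cowedge f (fun d : D => d)).
rewrite -(day_endoE (fun p : C * D => (f (fst p), snd p)) x y (fun p => p)).
rewrite -{2}[z](endo_id (F := H)).
by rewrite -(@day_cowedge (day_star F G) H A _ _ E E
  (fun p : C * D => (f (fst p), snd p)) (fun e : E => e)).
Qed.

Definition day_assoc_inv :
  NatTrans (day_star F (day_star G H)) (day_star (day_star F G) H).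
Proof.
exists (fun A => day_lift (@assoc_inv_subproof A)) => A B u.
apply: functional_extensionality; apply: day_ext => C D x t h.
move: t; apply: (@day_ind G H D) => C' D' y z k /=.
by rewrite !day_mapE !day_liftE !day_mapE.
Defined.

Lemma day_assoc_invE (A B C D E : SET) (x : F C) (y : G D) (k : D * E -> B)
    (z : H E) (h : C * B -> A) :
  day_assoc_inv A (@day_in F (day_star G H) A C B x (day_in y z k) h) =
  @day_in (day_star F G) H A (C * D)%type E (day_in x y (fun p => p)) z
    (fun q => h (fst (fst q), k (snd (fst q), snd q))).
Proof. by rewrite /= !day_liftE. Qed.

End Associator.

Lemma day_nat_ext (F G : SmallEndo) (H : Endo) (s t : NatTrans (day_star F G) H) :
  (forall A C D (x : F C) (y : G D) (k : C * D -> A),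
    s A (day_in x y k) = t A (day_in x y k)) -> s = t.
Proof.
move=> E; apply: nat_ext => A; apply: functional_extensionality.
exact: (@day_ext F G A).
Qed.

Lemma day_nat_ext3 (F G H : SmallEndo) (K : Endo)
    (s t : NatTrans (day_star (day_star F G) H) K) :
  (forall A B C D E (x : F C) (y : G D) (k : C * D -> B) (z : H E) (h : B * E -> A),
    s A (@day_in (day_star F G) H A B E (day_in x y k) z h) =
    t A (@day_in (day_star F G) H A B E (day_in x y k) z h)) -> s = t.
Proof.
move=> EE; apply: day_nat_ext => A B E u z h; move: u.
by apply: (@day_ind F G B) => C D x y k.
Qed.

Definition SmallDay : MonoidalCategory.
Proof.
unshelve refine (@Build_MonoidalCategory SmallFun day_star day_tensm _ _ Id_small
  day_assoc day_lunit day_runit _ _ _ _ _ _ _ _).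
- move=> F G; apply: day_nat_ext => A C D x y k.
  by rewrite day_tensmE.
- move=> F F' F'' G G' G'' s' s t' t; apply: day_nat_ext => A C D x y k.
  change (day_tensm (comp_nat s' s) (comp_nat t' t) A (day_in x y k) =
    day_tensm s' t' A (day_tensm s t A (day_in x y k))).
  by rewrite !day_tensmE.
- move=> F G H; exists (day_assoc_inv F G H); split.
  + apply: day_nat_ext3 => A B C D E x y k z h.
    change (day_assoc_inv F G H A (day_assoc F G H A
      (@day_in (day_star F G) H A B E (day_in x y k) z h)) =
      @day_in (day_star F G) H A B E (day_in x y k) z h).
    rewrite day_assocE day_assoc_invE /=.
    rewrite -[z in RHS](endo_id (F := H)) -(day_endoE k x y (fun p => p)).
    rewrite -(@day_cowedge (day_star F G) H A _ _ E E k (fun e => e)).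
    by apply: day_in_eq => -[[c d] e].
  + apply: day_nat_ext => A C B x t h; move: t.
    apply: (@day_ind G H B) => D E y z k.
    change (day_assoc F G H A (day_assoc_inv F G H A
      (@day_in F (day_star G H) A C B x (day_in y z k) h)) =
      @day_in F (day_star G H) A C B x (day_in y z k) h).
    rewrite day_assoc_invE day_assocE /=.
    rewrite -[x in RHS](endo_id (F := F)) -(day_endoE k y z (fun p => p)).
    rewrite -(@day_cowedge F (day_star G H) A C C _ _ (fun c => c) k).
    by apply: day_in_eq => -[c [d e]].
- move=> F.
  unshelve eexists (@Build_NatTrans SetCat SetCat F (day_star Id_small F)
    (fun A y => @day_in Id_small F A unit A tt y snd) _).
    move=> A B u; apply: functional_extensionality => y /=.
    rewrite day_mapE.
    by rewrite -(@day_cowedge Id_small F B unit unit A B (fun c => c) u).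
  split.
  + apply: day_nat_ext => A C D c y k /=.
    rewrite day_liftE.
    rewrite -(@day_cowedge Id_small F A unit unit D A (fun c => c)
      (fun d => k (c, d))).
    by rewrite (@day_cowedge Id_small F A unit C D D (fun _ => c) (fun d => d))
      endo_id.
  + apply: nat_ext => A; apply: functional_extensionality => y /=.
    by rewrite day_liftE /= endo_id.
- move=> F.
  unshelve eexists (@Build_NatTrans SetCat SetCat F (day_star F Id_small)
    (fun A x => @day_in F Id_small A A unit x tt fst) _).
    move=> A B u; apply: functional_extensionality => y /=.
    rewrite day_mapE.
    by rewrite -(@day_cowedge F Id_small B A B unit unit u (fun c => c)).
  split.
  + apply: day_nat_ext => A C D x d k /=.
    rewrite day_liftE.
    rewrite -(@day_cowedge F Id_small A C A unit unit (fun c => k (c, d))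
      (fun c => c)).
    by rewrite (@day_cowedge F Id_small A C C unit D (fun c => c) (fun _ => d))
      endo_id.
  + apply: nat_ext => A; apply: functional_extensionality => y /=.
    by rewrite day_liftE /= endo_id.
- move=> F F' G G' H H' s t r; apply: day_nat_ext3 => A B C D E x y k z h.
  change (day_assoc F' G' H' A (day_tensm (day_tensm s t) r A
      (@day_in (day_star F G) H A B E (day_in x y k) z h)) =
    day_tensm s (day_tensm t r) A (day_assoc F G H A
      (@day_in (day_star F G) H A B E (day_in x y k) z h))).
  rewrite (day_tensmE (F := day_star F G)) day_tensmE !day_assocE.
  by rewrite (day_tensmE (G := day_star G H)) day_tensmE.
- move=> F F' s; apply: day_nat_ext => A C D c y k.
  change (day_lunit F' A (day_tensm (id_nat Id_small) s A
      (@day_in Id_small F A C D c y k)) =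
    s A (day_lunit F A (@day_in Id_small F A C D c y k))).
  by rewrite day_tensmE !day_lunitE nat_endo.
- move=> F F' s; apply: day_nat_ext => A C D x d k.
  change (day_runit F' A (day_tensm s (id_nat Id_small) A
      (@day_in F Id_small A C D x d k)) =
    s A (day_runit F A (@day_in F Id_small A C D x d k))).
  by rewrite day_tensmE !day_runitE nat_endo.
- move=> F G; apply: day_nat_ext3 => A B C D E x d k z h.
  change (day_tensm (id_nat F) (day_lunit G) A (day_assoc F Id_small G A
      (@day_in (day_star F Id_small) G A B E (@day_in F Id_small B C D x d k) z h)) =
    day_tensm (day_runit F) (id_nat G) A
      (@day_in (day_star F Id_small) G A B E (@day_in F Id_small B C D x d k) z h)).
  rewrite day_assocE (day_tensmE (G := day_star Id_small G)) day_lunitE.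
  rewrite (day_tensmE (F := day_star F Id_small)) day_runitE /=.
  rewrite -(day_cowedge_l (fun c => k (c, d)) x z h).
  by rewrite -(day_cowedge_r (fun e : E => (d, e))).
- move=> F G H K; apply: day_nat_ext3 => A B C D E t y k z h; move: t.
  apply: (@day_ind F G C) => C1 C2 a b l.
  change (day_tensm (id_nat F) (day_assoc G H K) A
      (day_assoc F (day_star G H) K A
        (day_tensm (day_assoc F G H) (id_nat K) A
          (@day_in (day_star (day_star F G) H) K A B E
            (@day_in (day_star F G) H B C D (day_in a b l) y k) z h))) =
    day_assoc F G (day_star H K) A (day_assoc (day_star F G) H K A
      (@day_in (day_star (day_star F G) H) K A B E
        (@day_in (day_star F G) H B C D (day_in a b l) y k) z h))).
  rewrite (day_tensmE (F := day_star (day_star F G) H)) day_assocE.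
  rewrite (day_assocE (G := day_star G H)).
  rewrite (day_tensmE (G := day_star (day_star G H) K)) day_assocE.
  rewrite (day_assocE (F := day_star F G)) (day_assocE (H := day_star H K)) /=.
  pose r (p : C2 * (D * E)) := ((fst p, fst (snd p)), snd (snd p)).
  have -> : @day_in G (day_star H K) _ _ _ b (@day_in H K _ _ _ y z (fun p => p))
      (fun q => (fst q, fst (snd q), snd (snd q))) =
    fmap (day_star G (day_star H K)) r
      (@day_in G (day_star H K) _ _ _ b (day_in y z (fun p => p)) (fun p => p)).
    by rewrite (day_endoE (G := day_star H K)).
  by rewrite -(@day_cowedge_r F (day_star G (day_star H K)) A).
Defined.

(* The canonical strength of an endofunctor of Set. *)
Definition strength (F : Endo) (A B : SET) (p : A * F B) : F (A * B)%type :=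
  fmap F (fun b => (fst p, b)) (snd p).

Definition swap (A B : Type) (p : A * B) : B * A := (snd p, fst p).

(* F(C) x Z -> F(C x Z) *)
Definition strength_r (F : Endo) (C Z : SET) (p : F C * Z) : F (C * Z)%type :=
  fmap F (@swap Z C) (strength (swap p)).

(* C x (G(D) x K) -> G(C x D x K) *)
Definition strength_m (G : Endo) (C D K : SET) (p : C * (G D * K)) :
    G (C * D * K)%type :=
  fmap G (fun q : C * K * D => (fst (fst q), snd q, snd (fst q)))
    (strength ((fst p, snd (snd p)), fst (snd p))).

Definition ev (C D A : SET) (p : C * D * (C * D -> A)) : A := snd p (fst p).

(* The composite F(C) x G(D) x A^(C x D) -> F(C x (G(D) x A^(C x D)))
   -> F(G(C x D x A^(C x D))) -> F(G(A)). *)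
Definition day_to_comp (F G : Endo) (A C D : SET)
    (x : F C) (y : G D) (k : C * D -> A) : F (G A) :=
  fmap F (fmap G (@ev C D A)) (fmap F (@strength_m G C D (C * D -> A))
    (strength_r (x, (y, k)))).

(* Main.v *)
(* On representatives every structure map of the Day convolution is explicit,
   and two natural transformations out of an (iterated) Day convolution agree
   as soon as they agree on representatives. For instance both sides of the
   associativity law send [[x, y, k], z, h] to
   F(c |-> G(d |-> H(e |-> h(k(c, d), e))(z))(y))(x). *)

From Corelib Require Import ssreflect.
From Stdlib Require Import FunctionalExtensionality.
Require Import Defs.

Set Implicit Arguments.
Unset Strict Implicit.
Unset Printing Implicit Defensive.

Lemma endo_ext (F : Endo) (A B : SET) (f g : A -> B) (x : F A) :
  (forall a, f a = g a) -> fmap F f x = fmap F g x.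
Proof. by move=> /functional_extensionality ->. Qed.

(** Functoriality fuses the two strengths and the evaluation into one map under each functor; all
    later computations use this closed form. *)
Lemma day_to_compE (F G : Endo) (A C D : SET)
    (x : F C) (y : G D) (k : C * D -> A) :
  day_to_comp x y k = fmap F (fun c => fmap G (fun d => k (c, d)) y) x.
Proof.
rewrite /day_to_comp /strength_r /strength /= !endo_comp.
by apply: endo_ext => c; rewrite /strength_m /strength /= !endo_comp.
Qed.

(** The condition for descending to the coend: in closed form, reindexing [k] along [f] and [g] is
    functoriality of [F] and of [G]. *)
Lemma day_to_comp_cowedge (F G : Endo) (A : SET) :
  is_cowedge (@day_to_comp F G A).
Proof.
move=> C C' D D' f g x y k; rewrite !day_to_compE endo_comp.
by apply: endo_ext => c; rewrite endo_comp.
Qed.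

Definition day_comp (F G : SmallEndo) :
  NatTrans (day_star F G) (comp_small F G).
Proof.
exists (fun A => day_lift (@day_to_comp_cowedge F G A)) => A B u.
apply: functional_extensionality; apply: day_ext => C D x y k /=.
rewrite day_mapE !day_liftE !day_to_compE endo_comp.
by apply: endo_ext => c; rewrite endo_comp.
Defined.

Lemma day_compE (F G : SmallEndo) (A C D : SET)
    (x : F C) (y : G D) (k : C * D -> A) :
  day_comp F G A (day_in x y k) =
  fmap F (fun c => fmap G (fun d => k (c, d)) y) x.
Proof. by rewrite /= day_liftE day_to_compE. Qed.

(** On representatives, naturality of [s] moves it onto [x]; naturality of [t], used under [F'],
    moves it onto [y]. *)
Lemma day_comp_nat (F F' G G' : SmallEndo) (s : NatTrans F F')
    (t : NatTrans G G') :
  comp_nat (day_comp F' G') (day_tensm s t) =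
  comp_nat (comp_map s t) (day_comp F G).
Proof.
apply: day_nat_ext => A C D x y k.
change (day_comp F' G' A (day_tensm s t A (day_in x y k)) =
  comp_map s t A (day_comp F G A (day_in x y k))).
rewrite day_tensmE !day_compE /= endo_comp nat_endo.
by apply: endo_ext => c; rewrite nat_endo.
Qed.

Lemma day_comp_assoc (F G H : SmallEndo) :
  comp_nat (comp_nat (@assoc SmallComp F G H) (day_comp (comp_small F G) H))
    (day_tensm (day_comp F G) (id_nat H)) =
  comp_nat (comp_nat (day_comp F (comp_small G H))
    (day_tensm (id_nat F) (day_comp G H))) (day_assoc F G H).
Proof.
apply: day_nat_ext3 => A B C D E x y k z h.
(* The associator of [SmallComp] has identity components, so it disappears by conversion. *)
change (day_comp (comp_small F G) H A (day_tensm (day_comp F G) (id_nat H) A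
    (@day_in (day_star F G) H A B E (day_in x y k) z h)) =
  day_comp F (comp_small G H) A (day_tensm (id_nat F) (day_comp G H) A
    (day_assoc F G H A (@day_in (day_star F G) H A B E (day_in x y k) z h)))).
rewrite day_assocE (day_tensmE (F := day_star F G)).
rewrite (day_tensmE (G := day_star G H)) !day_compE /= endo_comp.
(* The outer layer [F] is already fused; [G] is fused under [c], then [H] under [d]. *)
apply: endo_ext => c; rewrite !endo_comp.
by apply: endo_ext => d; rewrite endo_comp.
Qed.

(** Mapping by [Id_small] is application, so the closed form of [day_comp] is convertible to that of
    [day_lunit]. *)
Lemma day_comp_lunit (F : SmallEndo) :
  comp_nat (@lunit SmallComp F) (day_comp Id_small F) = day_lunit F.
Proof.
apply: day_nat_ext => A C D c y k.
by rewrite day_lunitE; exact: (@day_compE Id_small F A C D c y k).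
Qed.

Lemma day_comp_runit (F : SmallEndo) :
  comp_nat (@runit SmallComp F) (day_comp F Id_small) = day_runit F.
Proof.
apply: day_nat_ext => A C D x d k.
by rewrite day_runitE; exact: (@day_compE F Id_small A C D x d k).
Qed.

Definition day_comp_lax : @LaxMonoidal SmallComp SmallDay (id_functor SmallFun).
Proof.
unshelve refine (@Build_LaxMonoidal SmallComp SmallDay (id_functor SmallFun)
  day_comp (id_nat Id_small) _ _ _ _).
- exact: day_comp_nat.
- exact: day_comp_assoc.
(* The unit morphism is an identity, so its tensor with an identity cancels. *)
- move=> F; rewrite (tensm_id (m := SmallDay)) (compm1 (c := SmallFun)).
  exact: day_comp_lunit.
- move=> F; rewrite (tensm_id (m := SmallDay)) (compm1 (c := SmallFun)).
  exact: day_comp_runit.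
Defined.

Theorem mainTheorem9 :
  exists L : @LaxMonoidal SmallComp SmallDay (id_functor SmallFun),
    lax_unit L = idm (Id_small : Ob SmallFun) /\
    (forall (F G : SmallEndo) (A C D : SET)
            (x : F C) (y : G D) (k : C * D -> A),
       lax_mul L F G A (day_in x y k) = day_to_comp x y k /\
       lax_mul L F G A (day_in x y k)
       = fmap F (fun c : C => fmap G (fun d : D => k (c, d)) y) x).
Proof.
(* [day_comp_lax] is transparent: its unit and multiplication reduce to [id_nat Id_small] and
   [day_comp]. *)
exists day_comp_lax; split=> // F G A C D x y k.
by rewrite day_to_compE; split; exact: day_compE.
Qed.
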